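(* Let $F$ be a number field with ring of integers $\mathcal{O}_F$, let $D$ be a finite set of primes of $\mathcal{O}_F$ containing all primes dividing $2$, and let $\mathcal{O}_{F,D}$ be the localization of $\mathcal{O}_F$ at $D$. Let $\phi=(x-\gamma)^2-c_1$ with $\gamma,c_1\in\mathcal{O}_{F,D}[t]$, and suppose that $\phi$ is not isotrivial and $c_1\neq 0$. Then there exists an effective constant $N_\phi\in\mathbb{N}$ with the following property: whenever $\mathfrak{p}$ is a prime of $\mathcal{O}_{F,D}$ such that the reduction $\phi_\mathfrak{p}\in\mathbb{F}_\mathfrak{p}[t][x]$ is not isotrivial and $c_1\not\equiv 0\bmod\mathfrak{p}$, and $n\in\mathcal{Z}_s(\phi_\mathfrak{p})$, then $n\leq N_\phi$.
   Context: $\mathcal{O}_{F,D}$ denotes the ring of elements of $F$ allowed to have denominators lying in primes of $D$ only. For a prime $\mathfrak{p}$ of $\mathcal{O}_{F,D}$, $\mathbb{F}_\mathfrak{p}=\mathcal{O}_F/\mathfrak{p}$ and $\phi_\mathfrak{p}$ is obtained by reducing the coefficients of $\gamma$ and $c_1$ modulo $\mathfrak{p}$. For a field $k$ of characteristic $\neq 2$ and $\phi=(x-\gamma)^2-c_1\in k[t][x]$: $\phi$ is isotrivial if there exists $m\in k[t]$ with $\phi(x-m)+m\in k[x]$, equivalently $\deg(\gamma+c_1)=0$. The adjusted post-critical orbit of $\phi$ is the sequence $c_1=-\phi(\gamma)$, $c_n=\phi^{(n)}(\gamma)$ for $n\ge 2$, where $\phi^{(n)}$ is the $n$-th iterate.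 A squarefree primitive prime divisor of $c_n$ is an irreducible $g\in k[t]$ with $g\mid c_n$, $g\nmid c_i$ for every $i<n$ with $c_i\neq 0$, and $v_g(c_n)$ odd. The squarefree Zsigmondy set is $\mathcal{Z}_s(\phi)=\{n\in\mathbb{N}: c_n \text{ has no squarefree primitive prime divisor}\}$. *)

(* Defs.v *)
From HB Require Import structures.
From mathcomp Require Import all_boot all_order all_algebra all_field.
From mathcomp Require Import ring_quotient.
From mathcomp Require Import boolp classical_sets cardinality.

Set Implicit Arguments.
Unset Strict Implicit.
Unset Printing Implicit Defensive.

Import GRing.Theory Num.Theory.
Local Open Scope ring_scope.
Local Open Scope quotient_scope.

(* A number field is a [fieldExtType rat].                                    *)

Section Integers.
Variable F : fieldExtType rat.

Definition integers_pred : {pred F} :=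
  fun x => `[< integralOver (intr : int -> F) x >].

Record integers := Integers {
  integers_val : F;
  integers_valP : integers_val \in integers_pred }.

HB.instance Definition _ := [isSub for integers_val].
HB.instance Definition _ := [Choice of integers by <:].

Fact integers_subring : subring_closed integers_pred.
Proof.
split=> [|x y /asboolP hx /asboolP hy|x y /asboolP hx /asboolP hy].
- exact/asboolP/integral1.
- exact/asboolP/integral_sub.
- exact/asboolP/integral_mul.
Qed.

HB.instance Definition _ :=
  GRing.SubChoice_isSubComNzRing.Build F integers_pred integers
    integers_subring.

Fact integers_val_neq0 (b : integers) : b != 0 -> val b != 0.
Proof. by apply: contraNneq => b0; apply/eqP/val_inj; rewrite b0 rmorph0. Qed.

End Integers.

(* The primes of a Dedekind domain are its nonzero prime ideals.              *)
Record nzprime (R : comNzRingType) := NzPrime {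
  nzprime_pred : R -> bool;
  nzprime_ideal : idealr_closed nzprime_pred;
  nzprime_prime : prime_idealr_closed nzprime_pred;
  nzprime_neq0 : exists2 x : R, x \in nzprime_pred & x != 0 }.

Definition nzprime_mem (R : comNzRingType) (p : nzprime R) : {pred R} :=
  nzprime_pred p.
Coercion nzprime_mem : nzprime >-> pred_sort.

HB.instance Definition _ (R : comNzRingType) (p : nzprime R) :=
  isIdealr.Build R (nzprime_mem p) (nzprime_ideal p).
HB.instance Definition _ (R : comNzRingType) (p : nzprime R) :=
  isPrimeIdealrClosed.Build R (nzprime_mem p) (@nzprime_prime R p).

Section Localization.
Variables (F : fieldExtType rat) (D : set (nzprime (integers F))).

(* Fractions a / b such that every prime dividing b belongs to D.             *)
Definition Dintegers_pred : {pred F} := fun x =>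
  `[< exists a b : integers F,
      [/\ b != 0, forall q : nzprime (integers F), b \in q -> D q
        & x = val a / val b] >].

Record Dintegers := DIntegers {
  Dintegers_val : F;
  Dintegers_valP : Dintegers_val \in Dintegers_pred }.

HB.instance Definition _ := [isSub for Dintegers_val].
HB.instance Definition _ := [Choice of Dintegers by <:].

Let mul_neq0 (b b' : integers F) : b != 0 -> b' != 0 -> b * b' != 0.
Proof.
move=> /integers_val_neq0 hb /integers_val_neq0 hb'; apply: contraTneq (mulf_neq0 hb hb').
by move=> /(congr1 val); rewrite rmorphM rmorph0 => ->; rewrite eqxx.
Qed.

Let subf_div (u v u' v' : F) : v != 0 -> v' != 0 ->
  u / v - u' / v' = (u * v' - u' * v) / (v * v').
Proof. by move=> v0 v'0; rewrite -mulNr addf_div // mulNr. Qed.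

Fact Dintegers_subring : subring_closed Dintegers_pred.
Proof.
split=> [|x y /asboolP[a [b [b0 hb ->]]] /asboolP[a' [b' [b'0 hb' ->]]]
         |x y /asboolP[a [b [b0 hb ->]]] /asboolP[a' [b' [b'0 hb' ->]]]].
- apply/asboolP; exists 1, 1; split; first exact: oner_neq0.
    by move=> q; rewrite idealr1.
  by rewrite rmorph1 divr1.
- apply/asboolP; exists (a * b' - a' * b), (b * b'); split.
  + exact: mul_neq0.
  + by move=> q; rewrite prime_idealrM => /orP[/hb|/hb'].
  + by rewrite rmorphB !rmorphM; apply: subf_div; apply: integers_val_neq0.
- apply/asboolP; exists (a * a'), (b * b'); split.
  + exact: mul_neq0.
  + by move=> q; rewrite prime_idealrM => /orP[/hb|/hb'].
  + by rewrite !rmorphM; apply: mulf_div.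
Qed.

HB.instance Definition _ :=
  GRing.SubChoice_isSubComNzRing.Build F Dintegers_pred Dintegers
    Dintegers_subring.

End Localization.

Section ResidueField.
Variables (F : fieldExtType rat) (D : set (nzprime (integers F))).
Variable p : nzprime (Dintegers D).

Definition residue_field : Type := {ideal_quot (nzprime_mem p : prime_idealr _)}.

HB.instance Definition _ := GRing.ComNzRing.on residue_field.

Definition residue (x : Dintegers D) : residue_field := \pi_({ideal_quot (nzprime_mem p : prime_idealr _)}) x.

Fact residue_is_zmod_morphism : zmod_morphism residue.
Proof. by move=> x y; rewrite /residue !piE. Qed.

Fact residue_is_monoid_morphism : monoid_morphism residue.
Proof. by split=> [|x y]; rewrite /residue !piE. Qed.

HB.instance Definition _ := GRing.isZmodMorphism.Build
  (Dintegers D) residue_field residue residue_is_zmod_morphism.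
HB.instance Definition _ := GRing.isMonoidMorphism.Build
  (Dintegers D) residue_field residue residue_is_monoid_morphism.

Fact residue_eq0 x : (residue x == 0) = (x \in p).
Proof.
rewrite -(rmorph0 residue) -[x in RHS]subr0.
by rewrite [RHS](Quotient.idealrBE (nzprime_mem p : prime_idealr _)).
Qed.

Fact residue_surj z : exists x, residue x = z.
Proof. by exists (repr z); rewrite /residue reprK. Qed.

Let residue_mul0 (x y : residue_field) : x * y = 0 -> x = 0 \/ y = 0.
Proof.
by move/Quotient.rquot_IdomainAxiom => /orP[/eqP->|/eqP->]; [left|right].
Qed.

Let monic_split (f : {poly int}) : f \is monic -> f != 1 ->
  exists2 g : {poly int}, g \is monic & exists c, f = g * 'X + c%:P
    /\ (size g < size f)%N.
Proof.
elim/poly_ind: f => [|g c _]; first by rewrite monicE lead_coef0.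
have [->|g0] := eqVneq g 0.
  rewrite mul0r add0r monicE lead_coefC => /eqP ->.
  by rewrite eqxx.
have sg : (size c%:P < size (g * 'X)%R)%N.
  by rewrite size_mulX // (leq_ltn_trans (size_polyC_leq1 _)) // ltnS size_poly_gt0.
rewrite monicE lead_coefDl // lead_coefMX -monicE => gm _.
by exists g => //; exists c; rewrite size_polyDl // size_mulX.
Qed.

Let Z2A : {rmorphism int -> residue_field} := intr.

Let integral_inverse l (f : {poly int}) (z : residue_field) :
  prime l -> l%:R = 0 :> residue_field -> f \is monic ->
  root (map_poly Z2A f) z -> z != 0 -> exists y, y * z = 1.
Proof.
move=> pl l0; have [n] := ubnP (size f); elim: n f => // n IH f.
rewrite ltnS => sf fm fz z0.
have [f1|f1] := eqVneq f 1.
  by move: fz; rewrite f1 rmorph1 rootE hornerC oner_eq0.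
have [g gm [c [ef sg]]] := monic_split fm f1.
move: fz; rewrite ef rmorphD rmorphM /= map_polyX map_polyC /= rootE !hornerE.
have [c0|c0] := eqVneq (Z2A c) 0.
  rewrite c0 addr0 => /eqP/residue_mul0[] gz; last by rewrite gz eqxx in z0.
  by apply: (IH g) => //; [exact: leq_trans sg sf | rewrite rootE gz].
move=> /eqP; rewrite addrC => /addr0_eq gz.
have {}l0 : Z2A l = 0 by exact: l0.
have cop : coprimez c l.
  rewrite coprimez_sym coprimezE /= prime_coprime //.
  apply: contra c0 => lc; have /dvdzP[k ->] : (l %| c)%Z by rewrite dvdzE.
  by rewrite rmorphM /= [Z2A l]l0 mulr0.
have /coprimezP[[u v] /= uv] := cop.
exists (- Z2A u * (map_poly Z2A g).[z]).
rewrite -mulrA -gz mulrNN -rmorphM.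
have : Z2A (u * c + v * l) = 1 by rewrite uv rmorph1.
by rewrite rmorphD (rmorphM Z2A v) /= [Z2A l]l0 mulr0 addr0.
Qed.

Let Dintegers_of (a : integers F) :
  exists2 x : Dintegers D, val x = val a &
    exists2 f : {poly int}, f \is monic & root (map_poly intr f) x.
Proof.
have aP : val a \in Dintegers_pred D.
  apply/asboolP; exists a, 1; split; first exact: oner_neq0.
    by move=> q; rewrite (idealr1 (nzprime_mem q : prime_idealr _)).
  by rewrite rmorph1 divr1.
exists (DIntegers aP) => //.
have /asboolP[f fm fa] := valP a; exists f => //.
rewrite rootE; apply/eqP/val_inj; rewrite rmorph0 -horner_map.
rewrite [X in X.[_]](_ : _ = map_poly intr f); first exact/eqP.
by apply/polyP=> i; rewrite !coef_map; apply: rmorph_int.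
Qed.

Let prime_in_ideal : exists2 l, prime l & l%:R = 0 :> residue_field.
Proof.
have [x xp x0] := nzprime_neq0 p.
have /asboolP[a [b [b0 _ ex]]] := valP x.
have [a' ea [f fm fa]] := Dintegers_of a.
have [b' eb _] := Dintegers_of b.
have vb0 : val b != 0 by apply: integers_val_neq0.
have a'E : a' = b' * x.
  by apply: val_inj; rewrite rmorphM /= ea eb ex mulrC divfK.
have vx0 : val x != 0.
  by apply: contraNneq x0 => h; apply/eqP/val_inj; rewrite h rmorph0.
have va'0 : val a' != 0 by rewrite a'E rmorphM /= mulf_neq0 // eb.
have pa' : residue a' = 0.
  have xr : residue x = 0 by apply/eqP; rewrite residue_eq0.
  have -> : residue a' = residue b' * residue x by rewrite a'E; apply: rmorphM.
  by rewrite xr mulr0.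
have [c c0 cA] : exists2 c : int, c != 0 & Z2A c = 0.
  have [n] := ubnP (size f); elim: n f fm fa => // n IH f fm fa.
  rewrite ltnS => sf; have [f1|f1] := eqVneq f 1.
    by move: fa; rewrite f1 rmorph1 rootE hornerC oner_eq0.
  have [g gm [c [ef sg]]] := monic_split fm f1.
  move: fa; rewrite ef rmorphD rmorphM /= map_polyX map_polyC /= rootE !hornerE.
  have [->|c0] := eqVneq c 0; last first.
    move=> /eqP/(congr1 residue); rewrite rmorphD rmorphM rmorph0 /= pa' mulr0.
    by rewrite add0r rmorph_int => cA; exists c.
  rewrite rmorph0 addr0 => /eqP/(congr1 val); rewrite rmorphM rmorph0 => /eqP.
  rewrite mulf_eq0 (negPf va'0) orbF => /eqP g0.
  apply: (IH g) => //; last exact: leq_trans sg sf.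
  by rewrite rootE; apply/eqP/val_inj; rewrite g0 rmorph0.
have : exists2 n, (0 < n)%N & n%:R = 0 :> residue_field.
  exists `|c|%N; first by rewrite absz_gt0.
  case: c c0 cA => [n|n] _ //; rewrite NegzE rmorphN => /eqP.
  by rewrite oppr_eq0 => /eqP.
case=> n; have [m] := ubnP n; elim: m n => // m IH n; rewrite ltnS => nm n0 nA.
have n1 : (1 < n)%N.
  rewrite ltn_neqAle n0 andbT; apply/eqP => n1.
  by move: nA; rewrite -n1 => /eqP; rewrite oner_eq0.
have := pdiv_dvd n => /dvdnP[k nk]; have pl := pdiv_prime n1.
have : k%:R * (pdiv n)%:R = 0 :> residue_field by rewrite -natrM -nk.
case/residue_mul0 => [kA|]; last by exists (pdiv n).
have k0 : (0 < k)%N by move: n0; rewrite {1}nk muln_gt0 => /andP[].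
apply: (IH k) => //; apply: leq_trans nm.
by rewrite [in X in (_ < X)%N]nk ltn_Pmulr // prime_gt1.
Qed.

Let residue_inverse (z : residue_field) : z != 0 -> exists y, y * z = 1.
Proof.
have [x <-] := residue_surj z => x0.
have /asboolP[a [b [b0 bD ex]]] := valP x.
have [a' ea [f fm fa]] := Dintegers_of a.
have [b' eb _] := Dintegers_of b.
have vb0 : val b != 0 by apply: integers_val_neq0.
have ibP : (val b)^-1 \in Dintegers_pred D.
  by apply/asboolP; exists 1, b; split => //; rewrite rmorph1 div1r.
have xb : x * b' = a' by apply: val_inj; rewrite rmorphM /= ea eb ex divfK.
have xE : x = a' * DIntegers ibP by apply: val_inj; rewrite rmorphM /= ea ex.
have a0 : residue a' != 0.
  by apply: contraNneq x0 => h; rewrite xE rmorphM /= h mul0r.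
have [l pl l0] := prime_in_ideal.
have fz : root (map_poly Z2A f) (residue a').
  rewrite rootE -[map_poly _ f](_ : map_poly residue (map_poly intr f) = _).
    by rewrite horner_map (eqP fa) rmorph0.
  by apply/polyP=> i; rewrite !coef_map; apply: rmorph_int.
have [y yE] := integral_inverse pl l0 fm fz a0.
exists (y * residue b'); rewrite -mulrA -rmorphM [b' * x]mulrC xb; exact: yE.
Qed.

Definition residue_inv (z : residue_field) : residue_field :=
  if pselect (exists y, y * z = 1) is left e then sval (cid e) else 0.

Fact residue_mulVf z : z != 0 -> residue_inv z * z = 1.
Proof.
rewrite /residue_inv; case: pselect => [e _|n /residue_inverse //].
exact: svalP (cid e).
Qed.

Fact residue_inv0 : residue_inv 0 = 0.
Proof.
rewrite /residue_inv; case: pselect => // e; have [y /eqP] := e.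
by rewrite mulr0 eq_sym oner_eq0.
Qed.

HB.instance Definition _ :=
  GRing.ComNzRing_isField.Build residue_field residue_mulVf residue_inv0.

End ResidueField.

Section Dynamics.
Variable k : fieldType.
Implicit Types (gamma c g a m q : {poly k}) (phi : {poly {poly k}}).

Definition quad gamma (c1 : {poly k}) : {poly {poly k}} :=
  ('X - gamma%:P) ^+ 2 - c1%:P.

Definition isotrivial phi : Prop :=
  exists m q, phi \Po ('X - m%:P) + m%:P = map_poly polyC q.

(* Only the values at n >= 1 are meaningful.                                  *)
Definition adjusted_orbit gamma (c1 : {poly k}) (n : nat) : {poly k} :=
  let phi := quad gamma c1 in
  if n == 1%N then - phi.[gamma] else iter n (horner phi) gamma.

(* The g-adic valuation of a for nonconstant g and nonzero a (g ^+ e %| a     *)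
(* then forces e < size a). The value is 0, an even number, at a = 0, whose   *)
(* valuation is infinite and hence not odd.                                   *)
Definition valuation g a : nat := \max_(e < size a | g ^+ e %| a) e.

Definition sqfree_primitive_divisor gamma (c1 : {poly k}) (n : nat) g : Prop :=
  let c := adjusted_orbit gamma c1 in
  [/\ irreducible_poly g,
      g %| c n,
      forall i : nat, (0 < i < n)%N -> c i != 0 -> ~~ (g %| c i)
    & odd (valuation g (c n))].

Definition sqfree_zsigmondy gamma (c1 : {poly k}) : set nat :=
  fun n => (0 < n)%N /\ ~ exists g, sqfree_primitive_divisor gamma c1 n g.

End Dynamics.

(* A constant attached to F, D, gamma and c1 is effective when one partial    *)
(* recursive function, independent of these data, computes it from every      *)
(* finite description of them (see [presents] below).                         *)
(* [computes f xs y] means that f is defined on the arguments xs, with value  *)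
(* y.                                                                         *)
Inductive recfun :=
  | RZero
  | RSucc
  | RProj of nat
  | RComp of recfun & seq recfun
  | RPrec of recfun & recfun
  | RMin of recfun.

Inductive computes : recfun -> seq nat -> nat -> Prop :=
  | computes_zero xs : computes RZero xs 0
  | computes_succ x xs : computes RSucc (x :: xs) x.+1
  | computes_proj i xs :
      (i < size xs)%N -> computes (RProj i) xs (nth 0%N xs i)
  | computes_comp f gs xs ys y :
      computes_all gs xs ys -> computes f ys y -> computes (RComp f gs) xs y
  | computes_prec0 f g xs y : computes f xs y -> computes (RPrec f g) (0%N :: xs) y
  | computes_precS f g n xs y z :
      computes (RPrec f g) (n :: xs) y -> computes g [:: n, y & xs] z ->
      computes (RPrec f g) (n.+1 :: xs) z
  | computes_min f n xs :
      computes f (n :: xs) 0 ->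
      (forall m, (m < n)%N -> exists y, computes f (m :: xs) y.+1) ->
      computes (RMin f) xs n
with computes_all : seq recfun -> seq nat -> seq nat -> Prop :=
  | computes_all_nil xs : computes_all [::] xs [::]
  | computes_all_cons g gs xs y ys :
      computes g xs y -> computes_all gs xs ys ->
      computes_all (g :: gs) xs (y :: ys).

Section Presentation.
Variables (F : fieldExtType rat) (D : set (nzprime (integers F))).

Definition coordinates (b : (\dim {:F}).-tuple F) (x : F) : seq rat :=
  [seq coord b i x | i <- enum 'I_(\dim {:F})].

Definition generates (R : comNzRingType) (s : seq R) (p : nzprime R) : Prop :=
  forall x, x \in p <-> exists a : nat -> R, x = \sum_(i < size s) a i * s`_i.

(* [presents gamma c1 w]: the natural numbers w are a finite description of   *)
(* F, D, gamma and c1. They encode, in this order and with respect to some    *)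
(* Q-basis b of F, the multiplication table of b, generators of each of the   *)
(* primes in D, and the coefficients of gamma and of c1. The encoding of      *)
(* lists of rationals by natural numbers is the one of [countType].           *)
Definition presents (gamma c1 : {poly Dintegers D}) (w : seq nat) : Prop :=
  exists (b : (\dim {:F}).-tuple F) (gens : seq (seq (integers F))),
    [/\ basis_of {:F} b,
        forall q, D q -> exists2 s, s \in gens & generates s q,
        forall s, s \in gens -> exists2 q, D q & generates s q
      & w = [:: pickle [seq [seq coordinates b (x * y) | y <- b] | x <- b];
                pickle [seq [seq coordinates b (val x) | x <- s] | s <- gens];
                pickle [seq coordinates b (val x) | x <- gamma : seq _];
                pickle [seq coordinates b (val x) | x <- c1 : seq _]]].

End Presentation.

(* Main.v *)
Require Import Defs.
From mathcomp Require Import all_boot all_order all_algebra all_field.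
From mathcomp Require Import ring_quotient.
From mathcomp Require Import boolp classical_sets cardinality.
From mathcomp Require Import ring zify.

Set Implicit Arguments.
Unset Strict Implicit.
Unset Printing Implicit Defensive.

Import GRing.Theory Num.Theory.
Local Open Scope ring_scope.

(* The bound holds over every perfect field k of characteristic not 2, and    *)
(* depends only on the degrees of gamma and c1, which reduction does not      *)
(* increase.                                                                  *)
(*   Put beta = gamma + c1 and let b_n be the n-th iterate of y^2 - beta at   *)
(* 0, so that c_n = +- (b_(n-1)^2 - c1). If n is in the Zsigmondy set, then   *)
(* the primes of odd multiplicity in c_n divide some c_i or some phi^i(0)     *)
(* with i <= n / 2, whence b_(n-1)^2 - c1 = d y^2 with d of degree            *)
(* O(2^(n/2)), unless 0 is periodic for phi. The latter forces c1 to be       *)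
(* gamma^2 or (gamma - 1)^2, and a factor of c_n of the form b_(n-2)^2 - C    *)
(* takes the place of c_n.                                                    *)
(*   Now let b^2 - C = d y^2 with b = X^2 - beta, X = Z^2 - beta and          *)
(* Z = W^2 - beta. As y divides (b^2 - C)', it divides 2 C b' - C' b, with    *)
(* a quotient e of small degree. Eliminating y gives                          *)
(* e^2 (b^2 - C) = d (2 C b' - C' b)^2, an identity in X and X' with small    *)
(* coefficients. Reading it modulo X, then modulo Z and W, forces             *)
(* beta' = C' = 0 as soon as beta^2 <> C. (If beta^2 = c1, split off the      *)
(* square b_(n-2)^2 from c_n and use C = 2 beta.)                             *)
(*   So gamma' = c1' = 0 for large n: both are p-th powers, and taking p-th   *)
(* roots preserves the Zsigmondy set and lowers the degree of beta.           *)

(** Four lemmas carry this argument. [squarefree_part] turns the Zsigmondy condition into b^2 - C =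
    d y^2 with d of small degree. [pell_deriv0] shows that this equation kills the derivatives of
    beta and C. [periodic_zero] settles the shape of c1 when 0 is periodic. [zsigmondy_le] descends
    along Frobenius. The argument applies to every residue field: 2 is invertible there
    ([residue_two_neq0]), and the field is perfect because its elements are quotients of elements
    algebraic over the prime field ([residue_field_perfect]). The bound is effective because it is
    linear in the sizes of gamma and c1, and the size of a coefficient list is the number of binary
    digits 1 of its code ([popcount_pickle]). *)

Definition pdeg (k : fieldType) (f : {poly k}) : nat := (size f).-1.

(** * Degrees, with the zero polynomial in degree 0 *)

Section Degree.
Variable k : fieldType.
Implicit Types f g h : {poly k}.

Lemma pdegD_max f g m n :
  (pdeg f <= m -> pdeg g <= n -> pdeg (f + g) <= maxn m n)%N.
Proof. rewrite /pdeg; have := size_polyD f g; lia. Qed.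

Lemma pdegN f : pdeg (- f) = pdeg f.
Proof. by rewrite /pdeg size_polyN. Qed.

Lemma pdegN_le f n : (pdeg f <= n -> pdeg (- f) <= n)%N.
Proof. by rewrite pdegN. Qed.

Lemma pdegM f g : f != 0 -> g != 0 -> pdeg (f * g) = (pdeg f + pdeg g)%N.
Proof.
move=> f0 g0; rewrite /pdeg size_mul //.
move: f0 g0; rewrite -!size_poly_gt0 => /prednK {1}<- /prednK <-.
by rewrite addnS addSn.
Qed.

Lemma pdegM_add f g m n :
  (pdeg f <= m -> pdeg g <= n -> pdeg (f * g) <= m + n)%N.
Proof. by move=> hf hg; have := size_polyMleq f g; rewrite /pdeg in hf hg *; lia. Qed.

Lemma pdegC (a : k) : pdeg a%:P = 0%N.
Proof. by rewrite /pdeg size_polyC; case: eqP. Qed.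

Lemma pdeg0 : pdeg (0 : {poly k}) = 0%N.
Proof. exact: pdegC 0. Qed.

Lemma pdeg1 : pdeg (1 : {poly k}) = 0%N.
Proof. exact: pdegC 1. Qed.

Lemma pdeg_nat m : pdeg (m%:R : {poly k}) = 0%N.
Proof. by rewrite -polyC_natr pdegC. Qed.

Lemma pdeg_nat_le m : (pdeg (m%:R : {poly k}) <= 0)%N.
Proof. by rewrite pdeg_nat. Qed.

Lemma pdeg_sqr f : pdeg (f ^+ 2) = (2 * pdeg f)%N.
Proof.
have [->|f0] := eqVneq f 0; first by rewrite expr0n /= /pdeg size_poly0.
by rewrite expr2 pdegM // mul2n addnn.
Qed.

Lemma pdeg_sqr_le f n : (pdeg f <= n -> pdeg (f ^+ 2) <= 2 * n)%N.
Proof. by rewrite pdeg_sqr leq_mul2l. Qed.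

Lemma pdeg_deriv f n : (pdeg f <= n -> pdeg f^`() <= n)%N.
Proof.
have [->|f0] := eqVneq f 0; first by rewrite deriv0.
rewrite /pdeg => fn; have : (size f^`() < size f)%N by apply: lt_size_deriv.
lia.
Qed.

Lemma pdeg_addl f g : (pdeg g < pdeg f)%N -> pdeg (f + g) = pdeg f.
Proof.
move=> h; have {}h : (size g < size f)%N by rewrite /pdeg in h; lia.
by rewrite /pdeg size_polyDl.
Qed.

Lemma pdeg_sqrB f g : (pdeg g < 2 * pdeg f)%N -> pdeg (f ^+ 2 - g) = (2 * pdeg f)%N.
Proof. by move=> h; rewrite pdeg_addl pdeg_sqr // pdegN. Qed.

Lemma pdeg_gt0_neq0 f : (0 < pdeg f)%N -> f != 0.
Proof. by apply: contraTneq => ->; rewrite /pdeg size_poly0. Qed.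

Lemma dvdp_pdeg f g : f %| g -> g != 0 -> (pdeg f <= pdeg g)%N.
Proof.
move=> fg g0; have h : (size f <= size g)%N by apply: dvdp_leq.
by rewrite /pdeg; lia.
Qed.

(** Turns a congruence modulo a polynomial of large degree into an equality; every step of the
    descent ends with it. *)
Lemma dvdp_pdeg_eq0 f g : f %| g -> (pdeg g < pdeg f)%N -> g = 0.
Proof.
by move=> fg h; apply/eqP; apply: contraTT h => /(dvdp_pdeg fg); rewrite -leqNgt.
Qed.

Lemma natr_poly_neq0 m : m%:R != 0 :> k -> m%:R != 0 :> {poly k}.
Proof. by rewrite -polyC_natr polyC_eq0. Qed.

Lemma dvdp_natl m f g : m%:R != 0 :> k -> (f %| m%:R * g) = (f %| g).
Proof. by move=> m0; rewrite -polyC_natr mul_polyC dvdpZr. Qed.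

End Degree.

(* A proof of [pdeg t <= N], where N is the arithmetic expression in the      *)
(* degrees of the atoms of t that the degree rules give.                      *)
Ltac pdeg_bound k t :=
  lazymatch t with
  | ?f + ?g => let p := pdeg_bound k f in let q := pdeg_bound k g in
    constr:(pdegD_max p q)
  | ?f * ?g => let p := pdeg_bound k f in let q := pdeg_bound k g in
    constr:(pdegM_add p q)
  | - ?f => let p := pdeg_bound k f in constr:(pdegN_le p)
  | ?f ^+ 2 => let p := pdeg_bound k f in constr:(pdeg_sqr_le p)
  | 1 => constr:(@pdeg_nat_le k 1)
  | ?m%:R => constr:(@pdeg_nat_le k m)
  | ?f^`() => let p := pdeg_bound k f in constr:(pdeg_deriv p)
  | ?f => constr:(leqnn (@pdeg k f))
  end.

Ltac pdeg_lia :=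
  lazymatch goal with
  | |- is_true (@pdeg ?k ?t <= _)%N =>
    let p := pdeg_bound k t in apply: (leq_trans p); lia
  | |- is_true (@pdeg ?k ?t < _)%N =>
    let p := pdeg_bound k t in apply: (leq_ltn_trans p); lia
  end.

(** * The equation b^2 - C = d y^2 and derivatives *)

Section Descent.
Variable k : fieldType.
Hypothesis two_neq0 : 2%:R != 0 :> k.
Variables (L : nat) (beta C d y W Z X b : {poly k}).
Hypotheses (ZE : Z = W ^+ 2 - beta) (XE : X = Z ^+ 2 - beta)
  (bE : b = X ^+ 2 - beta).
Hypotheses (C0 : C != 0) (Cbeta : beta ^+ 2 != C).
Hypotheses (beta_le : (pdeg beta <= L)%N) (C_le : (pdeg C <= L)%N)
  (d_le : (pdeg d <= L)%N) (W_gt : (3 * L < pdeg W)%N)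
  (W_deriv : beta^`() = 0 -> W^`() = 0).
Hypothesis pell : b ^+ 2 - C = d * y ^+ 2.

Let degZ : pdeg Z = (2 * pdeg W)%N.
Proof. by rewrite ZE pdeg_sqrB //; lia. Qed.
Let degX : pdeg X = (4 * pdeg W)%N.
Proof. by rewrite XE pdeg_sqrB degZ; lia. Qed.
Let degb : pdeg b = (8 * pdeg W)%N.
Proof. by rewrite bE pdeg_sqrB degX; lia. Qed.

Let two0 : 2%:R != 0 :> {poly k}.
Proof. exact: natr_poly_neq0. Qed.

Let dy0 : d * y ^+ 2 != 0.
Proof. by rewrite -pell pdeg_gt0_neq0 // pdeg_sqrB degb; lia. Qed.
Let d0 : d != 0.
Proof. by apply: contraNneq dy0 => ->; rewrite mul0r. Qed.
Let y0 : y != 0.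
Proof. by apply: contraNneq dy0 => ->; rewrite expr0n mulr0. Qed.
Let degy : (16 * pdeg W <= L + 2 * pdeg y)%N.
Proof.
have := congr1 (@pdeg k) pell; rewrite pdeg_sqrB degb; last lia.
by rewrite pdegM ?expf_neq0 // pdeg_sqr; lia.
Qed.

Let y_dvd_deriv : y %| 2%:R * b * b^`() - C^`().
Proof.
have -> : 2%:R * b * b^`() - C^`() = y * (d^`() * y + 2%:R * d * y^`()).
  transitivity ((b ^+ 2 - C)^`()); first by rewrite derivB deriv_exp /=; ring.
  by rewrite pell derivM deriv_exp /=; ring.
exact: dvdp_mulIl.
Qed.

Let C'_eq0 : beta^`() = 0 -> C^`() = 0.
Proof.
move=> beta'0; have := y_dvd_deriv; have W'0 := W_deriv beta'0.
have -> : b^`() = 0.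
  rewrite bE XE ZE !(derivB, deriv_exp) /= beta'0 W'0.
  by rewrite !(mulr0, mul0r, mul0rn, subr0).
rewrite mulr0 sub0r dvdpNr => /dvdp_pdeg_eq0; apply.
apply: (@leq_ltn_trans L); first exact: pdeg_deriv.
lia.
Qed.

(** As b = X^2 - beta, 2 C b' - C' b equals [X * U + kappa]; [kappa] is what remains modulo X, and
    its degree is at most 2 L. *)
Let kappa := C^`() * beta - 2%:R * C * beta^`().
Let U := 4%:R * C * X^`() - C^`() * X.

(** Here e is the quotient of 2 C b' - C' b by y: the product e y has degree at most L + 8 [pdeg W],
    and y at least 8 [pdeg W] - L / 2. *)
Let e_ex : exists2 e, (pdeg e <= 2 * L)%N &
  e ^+ 2 * (b ^+ 2 - C) = d * (X * U + kappa) ^+ 2.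
Proof.
have -> : X * U + kappa = 2%:R * C * b^`() - C^`() * b.
  by rewrite /U /kappa bE derivB deriv_exp /=; ring.
have /dvdpP[e eE] : y %| 2%:R * C * b^`() - C^`() * b.
  have -> : 2%:R * C * b^`() - C^`() * b =
     b * (2%:R * b * b^`() - C^`()) - 2%:R * b^`() * (b ^+ 2 - C) by ring.
  apply: dvdp_sub; apply: dvdp_mull => //.
  by rewrite pell; apply: dvdp_mull; rewrite expr2 dvdp_mulIl.
exists e; last by rewrite eE pell; ring.
have [->|e0] := eqVneq e 0; first by rewrite /pdeg size_poly0.
have : (pdeg (e * y) <= L + pdeg b)%N.
  by rewrite -eE; pdeg_lia.
by rewrite pdegM // degb; lia.
Qed.

Lemma pell_deriv0 : beta^`() = 0 /\ C^`() = 0.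
Proof.
suff beta'0 : beta^`() = 0 by split=> //; exact: C'_eq0.
have [e e_le eE] := e_ex.
(* The identity modulo X, where b is -beta and [X * U + kappa] is [kappa]. *)
have R0 : e ^+ 2 * (beta ^+ 2 - C) - d * kappa ^+ 2 = 0.
  apply: (@dvdp_pdeg_eq0 _ X).
    have -> : e ^+ 2 * (beta ^+ 2 - C) - d * kappa ^+ 2 =
      X * (e ^+ 2 * (2%:R * X * beta - X ^+ 3) + d * (X * U ^+ 2 + 2%:R * U * kappa))
      + (e ^+ 2 * (b ^+ 2 - C) - d * (X * U + kappa) ^+ 2).
      by rewrite bE; ring.
    by rewrite eE subrr addr0 dvdp_mulIl.
  by rewrite degX /kappa; pdeg_lia.
have X0 : X != 0 by rewrite pdeg_gt0_neq0 // degX; lia.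
have X'E : X^`() = 2%:R * Z * Z^`() - beta^`() by rewrite XE derivB deriv_exp /=; ring.
have [kappa0|kappa0] := eqVneq kappa 0.
  have e0 : e = 0.
    move/eqP: R0; rewrite kappa0 expr0n mulr0 subr0 mulf_eq0 subr_eq0 (negPf Cbeta).
    by rewrite orbF expf_eq0 => /eqP.
  have U0 : U = 0.
    move/esym/eqP: eE; rewrite e0 expr0n mul0r kappa0 addr0 mulf_eq0 (negPf d0).
    by rewrite expf_eq0 mulf_eq0 (negPf X0) => /eqP.
  (* U = 0 read modulo Z, where X is -beta and X' is -beta'. *)
  have h : 4%:R * C * beta^`() - C^`() * beta = 0.
    apply: (@dvdp_pdeg_eq0 _ Z); last first.
      by rewrite degZ; clear -beta_le C_le W_gt; pdeg_lia.
    have -> : 4%:R * C * beta^`() - C^`() * beta =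
      Z * (8%:R * C * Z^`() - C^`() * Z) - U by rewrite /U X'E XE; ring.
    by rewrite U0 subr0 dvdp_mulIl.
  have : 2%:R * C * beta^`() = 0.
    by transitivity ((4%:R * C * beta^`() - C^`() * beta) + kappa);
      [rewrite /kappa; ring | rewrite h kappa0 addr0].
  by move/eqP; rewrite !mulf_eq0 (negPf two0) (negPf C0) => /eqP.
(* Subtract [R0] from the identity, divide by X and reduce modulo X again: there U is 4 C X'. *)
have X'_dvd : X %| d * kappa * C * X^`().
  have h : e ^+ 2 * (X ^+ 3 - 2%:R * beta * X) = d * (X * U ^+ 2 + 2%:R * U * kappa).
    apply: (mulfI X0); apply/eqP; rewrite -subr_eq0; apply/eqP.
    transitivity ((e ^+ 2 * (b ^+ 2 - C) - d * (X * U + kappa) ^+ 2) -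
      (e ^+ 2 * (beta ^+ 2 - C) - d * kappa ^+ 2)); first by rewrite bE; ring.
    by rewrite eE R0 !subrr.
  rewrite -(@dvdp_natl _ 8); last by rewrite (natrM _ 2 4) (natrM _ 2 2) !mulf_neq0.
  have -> : 8%:R * (d * kappa * C * X^`()) =
    X * (2%:R * d * kappa * C^`() - d * U ^+ 2)
    + d * (X * U ^+ 2 + 2%:R * U * kappa) by rewrite /U; ring.
  have -> : d * (X * U ^+ 2 + 2%:R * U * kappa) = X * (e ^+ 2 * (X ^+ 2 - 2%:R * beta)).
    by rewrite -h; ring.
  by rewrite -mulrDr dvdp_mulIl.
(* Modulo X, Z^2 is beta, so Z X' is 2 beta Z' - beta' Z. The degrees require 5 L + 2 [pdeg W] < 4
   [pdeg W], the tightest use of [W_gt]. *)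
have Z_eq : 2%:R * beta * Z^`() - beta^`() * Z = 0.
  have : d * kappa * C * (2%:R * beta * Z^`() - beta^`() * Z) = 0.
    apply: (@dvdp_pdeg_eq0 _ X); last first.
      by rewrite degX /kappa; clear -beta_le C_le d_le W_gt degZ; pdeg_lia.
    have -> : d * kappa * C * (2%:R * beta * Z^`() - beta^`() * Z) =
      Z * (d * kappa * C * X^`()) - 2%:R * d * kappa * C * Z^`() * X.
      by rewrite X'E XE; ring.
    by rewrite dvdp_sub // dvdp_mull.
  by move/eqP; rewrite !mulf_eq0 (negPf d0) (negPf kappa0) (negPf C0) => /eqP.
(* [Z_eq] modulo W, where Z is -beta and Z' is -beta'. *)
have /eqP : beta * beta^`() = 0.
  apply: (@dvdp_pdeg_eq0 _ W); last by clear -beta_le W_gt; pdeg_lia.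
  have -> : beta * beta^`() = W * (4%:R * beta * W^`() - beta^`() * W)
    - (2%:R * beta * Z^`() - beta^`() * Z).
    by rewrite ZE derivB deriv_exp /=; ring.
  by rewrite Z_eq subr0 dvdp_mulIl.
by rewrite mulf_eq0 => /orP[] /eqP // ->; rewrite deriv0.
Qed.

End Descent.

(** * Irreducible factors, valuations and squarefree parts *)

Section Valuation.
Variable k : fieldType.
Implicit Types f g h d y E T : {poly k}.

Lemma irreducible_divisor f :
  (1 < size f)%N -> exists2 g, irreducible_poly g & g %| f.
Proof.
have [n] := ubnP (size f); elim: n f => // n IH f; rewrite ltnS => fn f1.
have [|/not_andP[//|]] := pselect (irreducible_poly f); first by exists f.
move=> /existsNP[q] /not_implyP[q1] /not_implyP[qf /negP].
have f0 : f != 0 by rewrite -size_poly_gt0; exact: ltn_trans f1.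
rewrite -(dvdp_size_eqp qf) => qf1.
have q0 : q != 0 by apply: contraNneq f0 => q0; rewrite -dvd0p -q0.
have qlt : (size q < size f)%N by rewrite ltn_neqAle qf1 dvdp_leq.
have [||g gi gq] := IH q; first exact: leq_trans qlt fn.
  by rewrite ltn_neqAle eq_sym q1 size_poly_gt0.
by exists g => //; exact: dvdp_trans gq qf.
Qed.

Lemma irreducible_dvdM g f h :
  irreducible_poly g -> (g %| f * h) = (g %| f) || (g %| h).
Proof.
move=> gi; apply/idP/orP => [|[]]; [|exact: dvdp_mulr|exact: dvdp_mull].
have [|gf] := boolP (g %| f); first by left.
by rewrite Gauss_dvdpr ?irreducible_poly_coprime //; right.
Qed.

Lemma factor_out g f : irreducible_poly g -> f != 0 ->
  exists e u, f = g ^+ e * u /\ ~~ (g %| u).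
Proof.
move=> gi; have [n] := ubnP (size f); elim: n f => // n IH f; rewrite ltnS => fn f0.
have [/dvdpP[u uE]|gf] := boolP (g %| f); last by exists 0%N, f; rewrite mul1r.
have u0 : u != 0 by apply: contraNneq f0 => u0; rewrite uE u0 mul0r.
have un : (size u < n)%N.
  apply: leq_trans fn; rewrite uE (size_mul u0 (irredp_neq0 gi)).
  case: gi => g1 _; move: g1; case: (size g) => [|[|m]] // _.
  by rewrite !addnS ltnS leq_addr.
have [e [v [vE gv]]] := IH u un u0.
by exists e.+1, v; split=> //; rewrite uE vE exprS; ring.
Qed.

Lemma valuation_eq g e u : irreducible_poly g -> ~~ (g %| u) ->
  valuation g (g ^+ e * u) = e.
Proof.
move=> gi gu; have u0 : u != 0 by apply: contraNneq gu => ->; rewrite dvdp0.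
have g0 := irredp_neq0 gi; have g1 : (1 < size g)%N by case: gi.
have ge0 m : g ^+ m != 0 by rewrite expf_neq0.
have lt_e : (e < size (g ^+ e * u)%R)%N.
  rewrite size_mul // -(@prednK (size (g ^+ e))) ?size_poly_gt0 // size_exp.
  rewrite addSn /=; move: u0 g1; rewrite -size_poly_gt0.
  case: (size u) => // m _; case: (size g) => [|[|l]] // _ /=.
  by rewrite mulSn addnS ltnS -addnA leq_addr.
apply/anti_leq/andP; split; last first.
  by apply: (@leq_bigmax_cond _ _ (fun i : 'I__ => nat_of_ord i) (Ordinal lt_e));
     rewrite dvdp_mulIl.
apply/bigmax_leqP => i; rewrite leqNgt; apply: contraL => ei.
apply: contra gu; rewrite -(subnKC ei) exprD exprSr -mulrA dvdp_mul2l //.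
by apply: dvdp_trans; rewrite dvdp_mulIl.
Qed.

Lemma valuationM g f h : irreducible_poly g -> f != 0 -> h != 0 ->
  valuation g (f * h) = (valuation g f + valuation g h)%N.
Proof.
move=> gi f0 h0; have [e [u [-> gu]]] := factor_out gi f0.
have [e' [u' [-> gu']]] := factor_out gi h0.
rewrite !valuation_eq //.
have -> : g ^+ e * u * (g ^+ e' * u') = g ^+ (e + e') * (u * u') by rewrite exprD; ring.
by rewrite valuation_eq // irreducible_dvdM // negb_or gu.
Qed.

Lemma valuationX g f m : irreducible_poly g -> f != 0 ->
  valuation g (f ^+ m) = (m * valuation g f)%N.
Proof.
move=> gi f0; elim: m => [|m IH].
  rewrite -[f ^+ 0](mul1r 1) -(expr0 g) valuation_eq // dvdp1.
  by case: gi => g1 _; rewrite neq_ltn g1 orbT.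
by rewrite exprS valuationM ?expf_neq0 // IH mulSn.
Qed.

Lemma valuation_ndvd g f : irreducible_poly g -> ~~ (g %| f) -> valuation g f = 0%N.
Proof. by move=> gi gf; rewrite -[f]mul1r -(expr0 g) valuation_eq. Qed.

Lemma odd_valuation_dvd g f : irreducible_poly g -> odd (valuation g f) -> g %| f.
Proof. by move=> gi; apply: contraTT => /valuation_ndvd ->. Qed.

Lemma valuationN g f : valuation g (- f) = valuation g f.
Proof. by rewrite /valuation size_polyN; apply: eq_bigl => i; rewrite dvdpNr. Qed.

(** Move squares of irreducibles into y until d is squarefree. Its primes then have odd multiplicity
    in E, so they divide T, and hence d divides T. *)
Lemma squarefree_part E T : E != 0 -> T != 0 ->
  (forall g, irreducible_poly g -> odd (valuation g E) -> g %| T) ->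
  exists d y, E = d * y ^+ 2 /\ (pdeg d <= pdeg T)%N.
Proof.
move=> E0 T0 ET.
suff H n d y : (size d < n)%N -> E = d * y ^+ 2 ->
    exists d y, E = d * y ^+ 2 /\ (pdeg d <= pdeg T)%N.
  by apply: (H (size E).+1 E 1); rewrite ?expr1n ?mulr1.
elim: n d y => // n IH d y; rewrite ltnS => dn dE.
have d0 : d != 0 by apply: contraNneq E0 => d0; rewrite dE d0 mul0r.
have y0 : y != 0 by apply: contraNneq E0 => y0; rewrite dE y0 expr0n mulr0.
have [[g [gi /dvdpP[q qE]]]|sqf] := pselect (exists g, irreducible_poly g /\ g ^+ 2 %| d).
  apply: (IH q (g * y)); last by rewrite dE qE; ring.
  have q0 : q != 0 by apply: contraNneq d0 => q0; rewrite qE q0 mul0r.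
  have g0 := irredp_neq0 gi.
  apply: leq_trans dn; rewrite qE size_mul ?expf_neq0 //.
  have : (2 < size (g ^+ 2)%R)%N.
    have := size_exp g 2; case: gi; case: (size g) => [|[|m]] // _ _ /=.
    by case: (size (g ^+ 2)) => // s /= ->; lia.
  by case: (size (g ^+ 2)) => [|[|m]] // _; rewrite !addnS ltnS leq_addr.
exists d, y; split=> //; apply: dvdp_pdeg => //.
have gT g : irreducible_poly g -> g %| d -> g %| T.
  move=> gi gd; apply: ET => //; rewrite dE valuationM ?expf_neq0 // valuationX //.
  rewrite mul2n oddD odd_double addbF.
  have /dvdpP[q qE] := gd; rewrite qE mulrC -[g in g * q]expr1 valuation_eq //.
  apply/negP => /dvdpP[r rE]; apply: sqf; exists g; split=> //.
  by rewrite qE rE -mulrA -expr2 dvdp_mulIr.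
have /dvdpP[q qE] := dvdp_gcdl d T.
have q0 : q != 0 by apply: contraNneq d0 => q0; rewrite qE q0 mul0r.
have [q1|q1] := leqP (size q) 1.
  have q1' : size q == 1%N by rewrite eqn_leq q1 size_poly_gt0.
  have /size_poly1P[a a0 qa] := q1'.
  by rewrite qE qa mul_polyC dvdpZl // dvdp_gcdr.
have [g gi gq] := irreducible_divisor q1.
case: sqf; exists g; split=> //; rewrite qE expr2 dvdp_mul //.
by rewrite dvdp_gcd gT // qE dvdp_mulr.
Qed.

End Valuation.

(** * The critical orbit and its primes *)

Section Orbits.
Variable k : fieldType.
Variables gamma c : {poly k}.
Implicit Types (g x C T : {poly k}).
Let beta := gamma + c.

Definition step x : {poly k} := (x - gamma) ^+ 2 - c.
(** Translating by gamma moves the critical point to 0 and conjugates phi to y^2 - beta. *)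
Definition crit n : {poly k} := iter n (fun y => y ^+ 2 - beta) 0.

Lemma horner_quad x : (quad gamma c).[x] = step x.
Proof. by rewrite /quad /step !hornerE. Qed.

Lemma iter_horner_quad n x : iter n (horner (quad gamma c)) x = iter n step x.
Proof. by elim: n => //= n ->; rewrite horner_quad. Qed.

Lemma iter_step_gamma n : iter n step gamma = gamma + crit n.
Proof.
elim: n => [|n IH]; first by rewrite addr0.
by rewrite !iterS IH /step /crit /= /beta; ring.
Qed.

Lemma iter_stepS_gamma n : iter n.+1 step gamma = crit n ^+ 2 - c.
Proof. by rewrite iter_step_gamma /crit iterS /beta; ring. Qed.

Lemma adjusted_orbitE n : adjusted_orbit gamma c n =
  if n == 1%N then - iter n step gamma else iter n step gamma.
Proof.
rewrite /adjusted_orbit /= iter_horner_quad; case: eqP => // ->.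
by rewrite horner_quad.
Qed.

Lemma dvdp_adjusted_orbit g n :
  (g %| adjusted_orbit gamma c n) = (g %| iter n step gamma).
Proof. by rewrite adjusted_orbitE; case: (n == 1%N); rewrite ?dvdpNr. Qed.

Lemma adjusted_orbit_eq0 n : (adjusted_orbit gamma c n == 0) = (iter n step gamma == 0).
Proof. by rewrite adjusted_orbitE; case: (n == 1%N); rewrite ?oppr_eq0. Qed.

Lemma valuation_adjusted_orbit g n :
  valuation g (adjusted_orbit gamma c n) = valuation g (iter n step gamma).
Proof. by rewrite adjusted_orbitE; case: (n == 1%N); rewrite ?valuationN. Qed.

Lemma zsigmondy_odd_dvd n g : sqfree_zsigmondy gamma c n ->
  irreducible_poly g -> odd (valuation g (iter n step gamma)) ->
  exists i, [/\ (0 < i < n)%N, iter i step gamma != 0 & g %| iter i step gamma].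
Proof.
case=> n0 nprim gi godd; apply: contrapT => noi; apply: nprim; exists g; split=> //.
- by rewrite dvdp_adjusted_orbit; exact: odd_valuation_dvd.
- move=> i ilt; rewrite adjusted_orbit_eq0 dvdp_adjusted_orbit => i0.
  by apply/negP => gdvd; apply: noi; exists i.
- by rewrite valuation_adjusted_orbit.
Qed.

Lemma pdeg_iter_step M n x : (pdeg gamma <= M)%N -> (pdeg c <= M)%N ->
  (pdeg x <= M)%N -> (pdeg (iter n step x) <= 2 ^ n * M)%N.
Proof.
move=> hg hc hx; elim: n => [|n IH]; first by rewrite mul1n.
have h : (M <= 2 ^ n * M)%N by rewrite leq_pmull // expn_gt0.
rewrite iterS /step expnS -mulnA; set N := (2 ^ n * M)%N in h IH *.
set z := iter _ _ _ in IH *; pdeg_lia.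
Qed.

(** As x - y divides phi(x) - phi(y), an orbit that meets a multiple of g follows the orbit of 0
    modulo g from there on. *)
Lemma dvdp_iter_stepB g n x : g %| x -> g %| iter n step x - iter n step 0.
Proof.
move=> gx; elim: n => [|n IH]; first by rewrite subr0.
have -> : iter n.+1 step x - iter n.+1 step 0 = (iter n step x - iter n step 0) *
   (iter n step x + iter n step 0 - 2%:R * gamma) by rewrite !iterS /step; ring.
exact: dvdp_mulr.
Qed.

Lemma dvdp_iter_step g n x : g %| x -> (g %| iter n step x) = (g %| iter n step 0).
Proof.
move=> /(dvdp_iter_stepB n) h.
by rewrite -[in LHS](subrK (iter n step 0) (iter n step x)) dvdp_addr.
Qed.

(* Let n be in the Zsigmondy set and g a prime of odd multiplicity in the     *)
(* n-th term. Then g divides an earlier nonzero term i: the i-th factor below *)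
(* if i <= n / 2, and otherwise, as phi^n(gamma) = phi^(n - i)(0) mod g, the  *)
(* second component of the (n - i)-th one.                                    *)
Definition imprimitive_part n : {poly k} :=
  \prod_(i < n) ((if iter i.+1 step gamma == 0 then 1 else iter i.+1 step gamma)
                 * iter i.+1 step 0).

Lemma imprimitive_part_neq0 n : (forall j, (0 < j)%N -> iter j step 0 != 0) ->
  imprimitive_part n != 0.
Proof.
move=> h; apply/prodf_neq0 => i _; rewrite mulf_neq0 ?h //.
by case: ifPn => // _; exact: oner_neq0.
Qed.

Lemma pdeg_imprimitive_part M n : (pdeg gamma <= M)%N -> (pdeg c <= M)%N ->
  (pdeg (imprimitive_part n) <= 4 * 2 ^ n * M)%N.
Proof.
move=> hg hc; elim: n => [|n IH].
  by rewrite /imprimitive_part big_ord0 pdeg1.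
rewrite /imprimitive_part big_ord_recr /=; set P := \prod_(i < n) _.
set Q := (if _ then _ else _).
have hQ : (pdeg Q <= 2 ^ n.+1 * M)%N.
  rewrite /Q; case: ifP => _; last by apply: (@pdeg_iter_step M n.+1 gamma).
  by rewrite pdeg1.
have h0 : (pdeg (iter n.+1 step 0%R) <= 2 ^ n.+1 * M)%N.
  by apply: pdeg_iter_step => //; rewrite pdeg0.
apply: leq_trans (pdegM_add IH (pdegM_add hQ h0)) _.
by rewrite expnS; nia.
Qed.

Lemma zsigmondy_dvd_imprimitive_part n g : sqfree_zsigmondy gamma c n ->
  irreducible_poly g -> odd (valuation g (iter n step gamma)) ->
  g %| imprimitive_part n./2.
Proof.
move=> nZ gi godd; have [i [/andP[i0 ilt] ci gci]] := zsigmondy_odd_dvd nZ gi godd.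
have dvd_prod (F : 'I_n./2 -> {poly k}) j : g %| F j -> g %| \prod_j F j.
  by move=> h; rewrite (bigD1 j) //= dvdp_mulr.
have [ile|igt] := leqP i n./2.
  have h : (i.-1 < n./2)%N by lia.
  apply: (dvd_prod _ (Ordinal h)); rewrite -[nat_of_ord _]/(i.-1) (prednK i0).
  by rewrite (negPf ci) dvdp_mulr.
have h : ((n - i).-1 < n./2)%N by lia.
apply: (dvd_prod _ (Ordinal h)); rewrite -[nat_of_ord _]/((n - i).-1).
have -> : (n - i).-1.+1 = (n - i)%N by lia.
apply: dvdp_mull; rewrite -(dvdp_iter_step (n - i) gci) -iterD subnK; last exact: ltnW.
exact: odd_valuation_dvd.
Qed.

Lemma deriv_crit n : beta^`() = 0 -> (crit n)^`() = 0.
Proof.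
move=> b0; elim: n => [|n IH]; first by rewrite deriv0.
by rewrite /crit iterS -/(crit n) derivB deriv_exp IH b0 mul0r mul0rn subr0.
Qed.

Hypothesis beta_gt0 : (0 < pdeg beta)%N.

Lemma pdeg_crit n : pdeg (crit n.+1) = (2 ^ n * pdeg beta)%N.
Proof.
elim: n => [|n IH]; first by rewrite /crit /= expr0n sub0r pdegN mul1n.
rewrite [crit _]iterS -/(crit n.+1) pdeg_sqrB IH ?expnS ?mulnA //.
by apply: (@leq_trans (2 * pdeg beta)); [lia|rewrite leq_pmul2r // leq_pmulr // expn_gt0].
Qed.

Hypothesis two_neq0 : 2%:R != 0 :> k.

(** Index m + 4 leaves room to go three steps down to W = [crit m.+1], still of degree at least 2^m
    > 3 L; T controls the squarefree part d. *)
Lemma crit_pell C T m L : C != 0 -> beta ^+ 2 != C ->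
  (pdeg beta <= L)%N -> (pdeg C <= L)%N -> (pdeg T <= L)%N -> (3 * L < 2 ^ m)%N ->
  T != 0 ->
  (forall g, irreducible_poly g -> odd (valuation g (crit m.+4 ^+ 2 - C)) -> g %| T) ->
  beta^`() = 0 /\ C^`() = 0.
Proof.
move=> C0 Cb bL CL TL mL T0 gT.
have mW : (2 ^ m <= pdeg (crit m.+1))%N by rewrite pdeg_crit leq_pmulr.
have E0 : crit m.+4 ^+ 2 - C != 0.
  apply: pdeg_gt0_neq0; rewrite pdeg_sqrB pdeg_crit !expnS; nia.
have [d [y [E dT]]] := squarefree_part E0 T0 gT.
apply: (@pell_deriv0 _ two_neq0 L beta C d y
  (crit m.+1) (crit m.+2) (crit m.+3) (crit m.+4)) => //.
- exact: leq_trans dT TL.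
- exact: leq_trans mL mW.
- exact: deriv_crit.
Qed.

(* Each difference of consecutive points of a cycle divides the next one, so  *)
(* all of them have the same degree and the quotients are constants.          *)
Lemma periodic_zero j : (0 < j)%N -> iter j step 0 = 0 ->
  c = gamma ^+ 2 \/ c = (gamma - 1) ^+ 2.
Proof.
move=> j0 per; pose z i := iter i step 0; pose D i := z i.+1 - z i.
have DS i : D i.+1 = D i * (z i.+1 + z i - 2%:R * gamma).
  by rewrite /D /z !iterS /step; ring.
have perz l : z (l * j)%N = 0.
  by elim: l => // l IH; rewrite mulSn /z iterD [iter (l * j) _ _]IH.
have perD l : D (l * j)%N = D 0%N by rewrite /D /z iterS -/(z (l * j)%N) perz.
have z1 : z 1%N = gamma ^+ 2 - c by rewrite /z /= /step; ring.
have [D0|D0] := eqVneq (D 0%N) 0.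
  by left; move: D0; rewrite /D z1 /z /= subr0 => /subr0_eq.
have Dn0 i : D i != 0.
  apply: contraNneq D0 => Di; rewrite -(perD i).
  (* A difference that vanishes at i stays zero up to i * j, a multiple of the period, where it
     equals [D 0]. *)
  have : (i <= i * j)%N by rewrite leq_pmulr.
  move: (i * j)%N => l /subnKC <-; elim: (l - i)%N => [|a IH]; first by rewrite addn0 Di.
  by rewrite addnS DS (eqP IH) mul0r.
have zn0 i : z i.+1 + z i - 2%:R * gamma != 0.
  by apply: contraNneq (Dn0 i.+1) => zi; rewrite DS zi mulr0.
have Dmono i l : (pdeg (D i) <= pdeg (D (i + l)%N))%N.
  elim: l => [|l IH]; first by rewrite addn0.
  by rewrite addnS DS pdegM // (leq_trans IH) // leq_addr.
have Dconst i : pdeg (D i) = pdeg (D 0%N).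
  apply/anti_leq/andP; split; last exact: (Dmono 0%N i).
  by rewrite -(perD i) -(@subnKC i (i * j)) ?Dmono // leq_pmulr.
have zconst i : pdeg (z i.+1 + z i - 2%:R * gamma) = 0%N.
  have := congr1 (@pdeg k) (DS i); rewrite pdegM // !Dconst; lia.
pose a := z 1%N + z 0%N - 2%:R * gamma; pose b := z 2 + z 1%N - 2%:R * gamma.
have a0 : pdeg a = 0%N by exact: zconst.
have b0 : pdeg b = 0%N by exact: zconst.
have z0 : z 0%N = 0 by [].
(* With a and b constant, this makes gamma constant unless a = -1. A constant gamma would make beta
   constant, and a = -1 gives c = (gamma - 1)^2. *)
have h : 2%:R * gamma * (1 + a) = b - a - a * (1 + a).
  have : D 1%N = D 0%N * a by rewrite DS.
  rewrite /D z0 subr0 => /eqP; rewrite subr_eq => /eqP z2E.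
  have z1E : z 1%N = a + 2%:R * gamma by rewrite /a z0; ring.
  have -> : b = z 2 + z 1%N - 2%:R * gamma by [].
  by rewrite z2E z1E; ring.
have [a1|a1] := eqVneq (1 + a) 0.
  right; transitivity (gamma ^+ 2 - z 1%N); first by rewrite z1; ring.
  transitivity (gamma ^+ 2 - (a + 2%:R * gamma)); first by rewrite /a z0; ring.
  by rewrite -[a](addKr 1) a1; ring.
have g0 : pdeg gamma = 0%N.
  have [->|gn0] := eqVneq gamma 0; first by rewrite pdeg0.
  have : (pdeg (2%:R * gamma * (1 + a)) <= 0)%N by rewrite h; pdeg_lia.
  rewrite pdegM // ?mulf_neq0 ?natr_poly_neq0 // pdegM ?natr_poly_neq0 //; lia.
have : (pdeg beta <= 0)%N.
  have -> : beta = gamma + gamma ^+ 2 - (a + 2%:R * gamma).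
    by rewrite /beta /a z1 z0; ring.
  pdeg_lia.
by rewrite leqn0 => /eqP b00; move: beta_gt0; rewrite b00.
Qed.

End Orbits.

(* For n above the bound, 2^(n - 6) exceeds three times the degree bound      *)
(* 4 * 2^(n / 2) * (a + b) of [imprimitive_part]: see [expn_bound].           *)
Definition zsigmondy_bound (a b : nat) : nat := (a + b).*2 + 32.

Lemma expn_bound n M : (M.*2 + 32 < n)%N ->
  (3 * (4 * 2 ^ n./2 * M) < 2 ^ (n - 6))%N.
Proof.
move=> hn; set h := n./2.
(* The factor 2^10 absorbs 12, and 2^M exceeds M. *)
have e : (n - 6 = h + 10 + M + (n - 6 - h - 10 - M))%N by rewrite /h; lia.
rewrite e !expnD; have M2 := ltn_expl M (isT : 1 < 2)%N.
have p0 : (0 < 2 ^ h)%N by rewrite expn_gt0.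
have q0 : (0 < 2 ^ (n - 6 - h - 10 - M))%N by rewrite expn_gt0.
have -> : (2 ^ 10 = 1024)%N by [].
move: M2 p0 q0; move: (2 ^ M)%N (2 ^ h)%N (2 ^ (n - 6 - h - 10 - M))%N => x y z M2 p0 q0.
have : (y * 1024 * x <= y * 1024 * x * z)%N by rewrite leq_pmulr.
by apply: leq_trans; nia.
Qed.

(** * Above the bound, both derivatives vanish *)

Section SeparableBound.
Variable k : fieldType.
Hypothesis two_neq0 : 2%:R != 0 :> k.
Variables gamma c : {poly k}.
Let beta := gamma + c.
Hypotheses (beta_gt0 : (0 < pdeg beta)%N) (c_neq0 : c != 0).
Variable n : nat.
Hypotheses (nZ : sqfree_zsigmondy gamma c n)
  (n_large : (zsigmondy_bound (size gamma) (size c) < n)%N).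

Let M := (size gamma + size c)%N.
Let L := (4 * 2 ^ n./2 * M)%N.
(** The offset 6 lets [crit_pell] apply both at index n - 1, to the n-th term, and at index n - 2,
    to a factor of it. *)
Let m := (n - 6)%N.

Let nE : n = m.+4.+2.
Proof. by move: n_large; rewrite /zsigmondy_bound /m; lia. Qed.

Let L_lt : (3 * L < 2 ^ m)%N.
Proof. exact: expn_bound. Qed.

Let gamma_le : (pdeg gamma <= M)%N. Proof. by rewrite /pdeg /M; lia. Qed.
Let c_le : (pdeg c <= M)%N. Proof. by rewrite /pdeg /M; lia. Qed.
Let ML : (4 * M <= L)%N.
Proof. by rewrite /L -mulnA leq_mul2l /= leq_pmull // expn_gt0. Qed.
Let beta_le : (pdeg beta <= M)%N. Proof. by rewrite /beta; pdeg_lia. Qed.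

Let orbn : iter n (step gamma c) gamma = crit gamma c m.+4.+1 ^+ 2 - c.
Proof. by rewrite {1}nE iter_stepS_gamma. Qed.
Let orbn1 : iter n.-1 (step gamma c) gamma = crit gamma c m.+4 ^+ 2 - c.
Proof. by rewrite nE iter_stepS_gamma. Qed.
Let orbnS : iter n (step gamma c) gamma = step gamma c (iter n.-1 (step gamma c) gamma).
Proof. by rewrite nE iterS. Qed.

Let large_neq0 C i : (pdeg C <= L)%N -> crit gamma c (m.+4 + i) ^+ 2 - C != 0.
Proof.
move=> CL; apply: pdeg_gt0_neq0.
have h : (2 ^ m <= pdeg (crit gamma c (m.+4 + i)))%N.
  rewrite addSn pdeg_crit //; apply: (@leq_trans (2 ^ (m.+3 + i) * 1)).
    by rewrite muln1 leq_exp2l //; lia.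
  by rewrite leq_mul2l beta_gt0 orbT.
rewrite pdeg_sqrB; lia.
Qed.

Let orb_neq0 : iter n (step gamma c) gamma != 0.
Proof. by rewrite orbn -addn1 large_neq0 //; lia. Qed.

(** Meant for periodic 0, where the iterates of 0 take at most two values. *)
Let earlier_term g : irreducible_poly g ->
  odd (valuation g (iter n (step gamma c) gamma)) ->
  exists l, g %| iter n.-1 (step gamma c) gamma - iter l (step gamma c) 0.
Proof.
move=> gi godd; have [i [/andP[i0 ilt] _ gci]] := zsigmondy_odd_dvd nZ gi godd.
exists (n.-1 - i)%N; have := dvdp_iter_stepB gamma c (n.-1 - i) gci.
by rewrite -iterD subnK //; lia.
Qed.

Let ndvdp_valuationM (g f h : {poly k}) :
  irreducible_poly g -> f * h != 0 -> ~~ (g %| f) ->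
  valuation g (f * h) = valuation g h.
Proof.
move=> gi; rewrite mulf_eq0 negb_or => /andP[f0 h0] gf.
by rewrite valuationM // valuation_ndvd.
Qed.

(* If phi(0) = 0 then phi(x) = x (x - 2 gamma), so every term divides the     *)
(* next one, and new primes of the n-th term come from the second factor.     *)
Let fixed_zero : c = gamma ^+ 2 -> gamma^`() = 0.
Proof.
move=> cE.
have degb : pdeg beta = (2 * pdeg gamma)%N.
  have g0 : (0 < pdeg gamma)%N.
    have : (pdeg (gamma + gamma ^+ 2) <= maxn (pdeg gamma) (2 * pdeg gamma))%N by pdeg_lia.
    by rewrite -cE -/beta; lia.
  rewrite /beta cE addrC -[gamma in _ + gamma]opprK pdeg_sqrB // pdegN; lia.
have g0 : (0 < pdeg gamma)%N by move: beta_gt0; rewrite degb; lia.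
have gn0 : gamma != 0 by exact: pdeg_gt0_neq0.
have g2 : gamma + 2%:R != 0.
  by apply: pdeg_gt0_neq0; rewrite pdeg_addl // pdeg_nat.
have g1 : gamma + 1 != 0.
  by apply: pdeg_gt0_neq0; rewrite pdeg_addl // pdeg1.
pose z := iter n.-1 (step gamma c) gamma.
have EE : crit gamma c m.+4 ^+ 2 - gamma * (gamma + 2%:R) = z - 2%:R * gamma.
  by rewrite /z orbn1; move: (crit _ _ _) => u; rewrite cE; ring.
have orbE : iter n (step gamma c) gamma = z * (z - 2%:R * gamma).
  by rewrite orbnS -/z; move: (z) => u; rewrite /step cE; ring.
have CL : (pdeg (gamma * (gamma + 2%:R)) <= 2 * pdeg gamma)%N by pdeg_lia.
have [||||||||_ /eqP] := @crit_pell _ gamma c beta_gt0 two_neq0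
   (gamma * (gamma + 2%:R)) gamma m L => //; rewrite -/beta.
- by rewrite mulf_neq0.
- by apply: contraTneq CL => <-; rewrite pdeg_sqr degb; lia.
- by lia.
- by lia.
- by lia.
(* A prime of odd multiplicity in z - 2 gamma that misses gamma also misses z, so its multiplicity
   in the n-th term is odd. As 0 is fixed, [earlier_term] then makes it divide z. *)
- move=> g gi; rewrite EE => godd; apply: contraT => gg.
  have gE := odd_valuation_dvd gi godd.
  have gz : ~~ (g %| z).
    apply: contra gg => gz; rewrite -(@dvdp_natl _ 2) //.
    by rewrite -[2%:R * gamma](subKr z) dvdp_sub.
  have [|l] := earlier_term gi; first by rewrite orbE ndvdp_valuationM // -orbE.
  have -> : iter l (step gamma c) 0 = 0.
    by elim: l => // l IH; rewrite iterS IH /step cE; ring.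
  by rewrite subr0 (negPf gz).
have -> : (gamma * (gamma + 2%:R))^`() = 2%:R * (gamma + 1) * gamma^`().
  by rewrite derivM derivD -polyC_natr derivC addr0; ring.
by rewrite !mulf_eq0 (negPf (natr_poly_neq0 two_neq0)) (negPf g1) => /eqP.
Qed.

(* Here phi(x) = (x - 1) (x - 2 gamma + 1) exchanges 0 and 2 gamma - 1, so a   *)
(* prime of the first factor that divides an earlier term divides gamma - 1.  *)
Let two_cycle_zero : c = (gamma - 1) ^+ 2 -> gamma^`() = 0.
Proof.
move=> cE.
have betaE : beta = gamma ^+ 2 - (gamma - 1) by rewrite /beta cE; ring.
have degb : pdeg beta = (2 * pdeg gamma)%N.
  have g0 : (0 < pdeg gamma)%N.
    have : (pdeg (gamma ^+ 2 - (gamma - 1)) <= 2 * pdeg gamma)%N by pdeg_lia.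
    by rewrite -betaE; lia.
  have h : (pdeg (gamma - 1) <= pdeg gamma)%N by pdeg_lia.
  by rewrite betaE pdeg_sqrB; lia.
have g0 : (0 < pdeg gamma)%N by move: beta_gt0; rewrite degb; lia.
have deg1 : pdeg (gamma - 1) = pdeg gamma by rewrite pdeg_addl // pdegN pdeg1.
have g1 : gamma - 1 != 0 by apply: pdeg_gt0_neq0; rewrite deg1.
pose z := iter n.-1 (step gamma c) gamma.
pose C := (gamma - 1) ^+ 2 - (-1).
have degC : pdeg C = (2 * pdeg gamma)%N.
  by rewrite /C pdeg_sqrB deg1 // pdegN pdeg1; lia.
have EE : crit gamma c m.+4 ^+ 2 - C = z - 1.
  by rewrite /z orbn1 /C; move: (crit _ _ _) => u; rewrite cE; ring.
have orbE : iter n (step gamma c) gamma = (z - (2%:R * gamma - 1)) * (z - 1).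
  by rewrite orbnS -/z; move: (z) => u; rewrite /step cE; ring.
have [||||||||_ /eqP] := @crit_pell _ gamma c beta_gt0 two_neq0
   C (gamma - 1) m L => //; rewrite -/beta.
- by apply: pdeg_gt0_neq0; rewrite degC; lia.
- by apply: contra_neq (pdeg_gt0_neq0 g0) => h; move: (congr1 (@pdeg k) h);
    rewrite pdeg_sqr degb degC; lia.
- by lia.
- by lia.
- by lia.
- move=> g gi; rewrite EE => godd; apply: contraT => gg.
  have gE := odd_valuation_dvd gi godd.
  have gz : ~~ (g %| z - (2%:R * gamma - 1)).
    apply: contra gg => gz; rewrite -(@dvdp_natl _ 2) //.
    have -> : 2%:R * (gamma - 1) = (z - 1) - (z - (2%:R * gamma - 1)) by ring.
    exact: dvdp_sub.
  have [|l] := earlier_term gi; first by rewrite orbE ndvdp_valuationM // -orbE.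
  have [->|->] : iter l (step gamma c) 0 = 0 \/
                 iter l (step gamma c) 0 = 2%:R * gamma - 1.
  - elim: l => [|l [] IH]; [by left|right|left];
      by rewrite iterS IH /step cE; ring.
  - rewrite subr0 -/z => gz'; have : g %| z - (z - 1) by rewrite dvdp_sub.
    by rewrite subKr dvdp1; case: gi => g1' _; rewrite gtn_eqF.
  - by rewrite (negPf gz).
have -> : C^`() = 2%:R * (gamma - 1) * gamma^`().
  rewrite /C derivB deriv_exp derivB derivN -polyC1 derivC /=; ring.
by rewrite !mulf_eq0 (negPf (natr_poly_neq0 two_neq0)) (negPf g1) => /eqP.
Qed.

(** Unless 0 is periodic, [imprimitive_part] is nonzero and serves as T in [crit_pell], with C = c,
    or C = 2 beta when beta^2 = c. *)
Lemma zsigmondy_deriv0 : gamma^`() = 0 /\ c^`() = 0.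
Proof.
have of_beta : beta^`() = 0 -> c^`() = 0 -> gamma^`() = 0 /\ c^`() = 0.
  by move=> + c'; rewrite /beta derivD c' addr0.
have [[j [j0 per]]|nper] := pselect (exists j, (0 < j)%N /\ iter j (step gamma c) 0 = 0).
  have [cE|cE] := periodic_zero beta_gt0 two_neq0 j0 per.
    by have g' := fixed_zero cE; split; rewrite // cE deriv_exp g' mul0r mul0rn.
  have g' := two_cycle_zero cE; split; rewrite // cE deriv_exp derivB g'.
  by rewrite -polyC1 derivC subr0 mul0r mul0rn.
have T0 : imprimitive_part gamma c n./2 != 0.
  by apply: imprimitive_part_neq0 => j j0; apply/eqP => per; apply: nper; exists j.
have TL : (pdeg (imprimitive_part gamma c n./2) <= L)%N by exact: pdeg_imprimitive_part.
have gT g := zsigmondy_dvd_imprimitive_part nZ (g := g).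
have [cb|cb] := eqVneq (beta ^+ 2) c; last first.
  have [||||||||b' c'] := @crit_pell _ gamma c beta_gt0 two_neq0
     c (imprimitive_part gamma c n./2) m.+1 L => //; rewrite -/beta; last exact: of_beta.
  - lia.
  - lia.
  - by rewrite expnS; lia.
  - by move=> g gi; rewrite -orbn; exact: gT.
have orbE : iter n (step gamma c) gamma =
    crit gamma c m.+4 ^+ 2 * (crit gamma c m.+4 ^+ 2 - 2%:R * beta).
  rewrite orbn [crit _ _ m.+4.+1]iterS -/(crit gamma c m.+4) -/beta.
  by move: (crit _ _ _) => u; rewrite -cb; ring.
have [||||||||b' _] := @crit_pell _ gamma c beta_gt0 two_neq0
   (2%:R * beta) (imprimitive_part gamma c n./2) m L => //; rewrite -/beta; last first.
- by apply: of_beta => //; rewrite -cb deriv_exp b' mul0r mul0rn.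
- move=> g gi godd; apply: gT => //; move: orb_neq0; rewrite orbE mulf_eq0 negb_or.
  move=> /andP[u0 v0]; rewrite valuationM // valuationX ?(expf_neq0 2) //.
    by rewrite mul2n oddD odd_double.
  by move: u0; rewrite expf_eq0.
- by pdeg_lia.
- lia.
- have b0 := pdeg_gt0_neq0 beta_gt0; apply: contraTneq beta_gt0 => h.
  have := congr1 (@pdeg k) h; rewrite pdeg_sqr pdegM ?natr_poly_neq0 // pdeg_nat.
  by rewrite -/beta; move: (pdeg beta); lia.
- by rewrite mulf_neq0 ?natr_poly_neq0 // pdeg_gt0_neq0.
Qed.

End SeparableBound.

(** * Frobenius descent and the bound over perfect fields *)

Section Frobenius.
Variables (k : fieldType) (p : nat).
Hypothesis charp : p \in [pchar k].

Let charP : p \in [pchar {poly k}].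
Proof. by rewrite pchar_poly. Qed.

Lemma poly_deriv0_coef (f : {poly k}) i : f^`() = 0 -> ~~ (p %| i)%N -> f`_i = 0.
Proof.
case: i => [|i] f'; first by rewrite dvdn0.
rewrite (dvdn_pcharf charp) => i0; have := coef_deriv f i.
rewrite f' coef0 => /esym/eqP; rewrite -mulr_natr mulf_eq0 (negPf i0) orbF.
by move=> /eqP.
Qed.

Lemma poly_deriv0_root (f : {poly k}) : (forall x : k, exists y, y ^+ p = x) ->
  f^`() = 0 -> exists g, f = g ^+ p.
Proof.
move=> /choice[r rE] f'; have p0 : (0 < p)%N := prime_gt0 (pcharf_prime charp).
exists (\poly_(i < size f) r f`_(i * p)); rewrite -(pFrobenius_autE charP) poly_def.
have -> : pFrobenius_aut charP (\sum_(i < size f) r f`_(i * p) *: 'X^i) =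
    (\poly_(i < size f) f`_(i * p)) \Po 'X^p.
  rewrite rmorph_sum poly_def linear_sum; apply: eq_bigr => i _ /=.
  by rewrite pFrobenius_autE exprZn rE linearZ /= comp_Xn_poly exprAC.
apply/polyP => i; rewrite comp_poly_Xn // [RHS]coef_poly.
set G := \poly_(_ < _) _.
have GE j : G`_j = f`_(j * p).
  rewrite coef_poly; case: ltnP => // h; rewrite nth_default //.
  by apply: leq_trans h _; rewrite leq_pmulr.
have [/dvdnP[j ->]|pi] := boolP (p %| i)%N; last first.
  by rewrite if_same poly_deriv0_coef.
rewrite mulnK // ltn_pmul2r //; case: ltnP => [|h]; first by rewrite GE.
by rewrite -GE nth_default.
Qed.

Lemma step_pchar (gamma c x : {poly k}) :
  step (gamma ^+ p) (c ^+ p) (x ^+ p) = (step gamma c x) ^+ p.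
Proof.
rewrite /step -!(pFrobenius_autE charP) !(rmorphB, rmorphXn) /=. by [].
Qed.

Lemma adjusted_orbit_pchar (gamma c : {poly k}) i :
  adjusted_orbit (gamma ^+ p) (c ^+ p) i = adjusted_orbit gamma c i ^+ p.
Proof.
have h : iter i (step (gamma ^+ p) (c ^+ p)) (gamma ^+ p) =
         iter i (step gamma c) gamma ^+ p.
  by elim: i => // i IH; rewrite !iterS IH step_pchar.
rewrite !adjusted_orbitE h; case: (i == 1%N) => //.
by rewrite -!(pFrobenius_autE charP) rmorphN.
Qed.

(** The p-th power multiplies valuations by the odd number p, which preserves parity and prime
    divisors. *)
Lemma zsigmondy_pchar (gamma c : {poly k}) n : odd p ->
  sqfree_zsigmondy (gamma ^+ p) (c ^+ p) n -> sqfree_zsigmondy gamma c n.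
Proof.
move=> podd [n0 noprim]; split=> // -[g [gi gn gprim godd]]; apply: noprim; exists g.
have p0 : (0 < p)%N by case: (p) podd.
have dvdX x : (g %| x ^+ p) = (g %| x).
  rewrite -(prednK p0); elim: p.-1 => [|q IH]; first by rewrite expr1.
  by rewrite exprS irreducible_dvdM // IH orbb.
split=> //; first by rewrite adjusted_orbit_pchar dvdX.
  move=> i ilt; rewrite adjusted_orbit_pchar dvdX expf_eq0 p0 /=; exact: gprim.
rewrite adjusted_orbit_pchar valuationX //; first by rewrite oddM podd.
by apply: contraTneq godd => ->; rewrite /valuation size_poly0 big_ord0.
Qed.

End Frobenius.

Theorem zsigmondy_le (k : fieldType) (gamma c : {poly k}) n :
  2%:R != 0 :> k ->
  (forall p, p \in [pchar k] -> forall x : k, exists y, y ^+ p = x) ->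
  (0 < pdeg (gamma + c))%N -> c != 0 -> sqfree_zsigmondy gamma c n ->
  (n <= zsigmondy_bound (size gamma) (size c))%N.
Proof.
move=> two0 perfect; have [d] := ubnP (pdeg (gamma + c)).
elim: d gamma c => // d IH gamma c; rewrite ltnS => dlt b0 c0 nZ.
rewrite leqNgt; apply/negP => nlt.
have [g' c'] := zsigmondy_deriv0 two0 b0 c0 nZ nlt.
(* A nonconstant beta with zero derivative forces positive characteristic. *)
have [p charp] : exists p, p \in [pchar k].
  have lc : (gamma + c)`_(pdeg (gamma + c)) != 0.
    by change (lead_coef (gamma + c) != 0); rewrite lead_coef_eq0 pdeg_gt0_neq0.
  apply: (natf0_pchar b0); have := coef_deriv (gamma + c) (pdeg (gamma + c)).-1.
  rewrite derivD g' c' addr0 coef0 prednK // => /esym/eqP.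
  by rewrite -[_ *+ _]mulr_natr mulf_eq0 => /orP[h|//]; case/negP: lc.
have pp := pcharf_prime charp.
have podd : odd p.
  have [p2|//] := even_prime pp; by rewrite -p2 (pcharf0 charp) eqxx in two0.
have [G GE] := poly_deriv0_root charp (perfect p charp) g'.
have [C CE] := poly_deriv0_root charp (perfect p charp) c'.
have charP : p \in [pchar {poly k}] by rewrite pchar_poly.
have bE : gamma + c = (G + C) ^+ p.
  by rewrite GE CE -!(pFrobenius_autE charP) rmorphD.
have degb : pdeg (gamma + c) = (pdeg (G + C) * p)%N by rewrite bE /pdeg size_exp.
have size_root (f : {poly k}) : (size f <= size (f ^+ p)%R)%N.
  have [->|f0] := eqVneq f 0; first by rewrite size_poly0.
  rewrite -(@prednK (size (f ^+ p)%R)) ?size_poly_gt0 ?expf_neq0 // size_exp.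
  rewrite -(@prednK (size f)) ?size_poly_gt0 // ltnS /= leq_pmulr // prime_gt0 //.
have B0 : (0 < pdeg (G + C))%N by move: b0; rewrite degb muln_gt0 => /andP[].
have : (n <= zsigmondy_bound (size G) (size C))%N.
  apply: IH => //.
  - by apply: leq_trans dlt; rewrite degb ltn_Pmulr // prime_gt1.
  - by apply: contraNneq c0 => C0; rewrite CE C0 expr0n gtn_eqF // prime_gt0.
  - by apply: (zsigmondy_pchar charp podd); rewrite -GE -CE.
move=> h; have := leq_trans nlt h; rewrite ltnNge /zsigmondy_bound => /negP; apply.
by rewrite leq_add2r leq_double leq_add // ?GE ?CE.
Qed.

(** For constant beta, m = -gamma conjugates phi to x^2 - beta, which has constant coefficients. *)
Lemma not_isotrivial_pdeg (k : fieldType) (gamma c : {poly k}) :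
  ~ isotrivial (quad gamma c) -> (0 < pdeg (gamma + c))%N.
Proof.
rewrite lt0n => niso; apply/eqP => b0; apply: niso.
have /size1_polyC cE : (size (gamma + c)%R <= 1)%N by rewrite /pdeg in b0; lia.
exists (- gamma), ('X ^+ 2 - ((gamma + c)`_0)%:P).
have -> : map_poly polyC ('X ^+ 2 - ((gamma + c)`_0)%:P) = 'X ^+ 2 - (gamma + c)%:P.
  by rewrite rmorphB rmorphXn /= map_polyX map_polyC /= -cE.
have -> : quad gamma c \Po ('X - (- gamma)%:P) = 'X ^+ 2 - c%:P.
  rewrite /quad comp_polyB rmorphXn /= comp_polyB comp_polyX !comp_polyC.
  by rewrite polyCN opprK addrK.
by rewrite polyCN polyCD; ring.
Qed.

(* The powers of z take finitely many values, so z^(p^i) = z^(p^j) for some   *)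
(* i < j, and the Frobenius map is injective.                                 *)
Lemma integral_pth_root (k : fieldType) (p : nat) (f : {poly int}) (z : k) :
  p \in [pchar k] -> f \is monic -> root (map_poly intr f) z ->
  exists y, y ^+ p = z.
Proof.
move=> charp fm fz; have p0 : (0 < p)%N := prime_gt0 (pcharf_prime charp).
have intrE (c : int) : c%:~R = (inord `|(c %% p)%Z| : 'I_p.+1)%:R :> k.
  have pz : p%:Z != 0 by rewrite -lt0n in p0 *; lia.
  have c_ge0 := modz_ge0 c pz.
  rewrite inordK; last by have := ltz_pmod c (_ : 0 < p%:Z); lia.
  rewrite {1}(divz_eq c p) rmorphD rmorphM /= -[p%:Z%:~R]/(p%:R).
  rewrite (pcharf0 charp) mulr0 add0r.
  by rewrite [RHS]pmulrn gez0_abs.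
(* Dividing by the monic f writes z^m through the z^i with i < [size f], with coefficients that
   matter only modulo p. *)
have /choice[F FE] (m : nat) : exists t : {ffun 'I_(size f) -> 'I_p.+1},
    z ^+ m = \sum_i (t i)%:R * z ^+ i.
  set r := Pdiv.Ring.rmodp 'X^m f.
  exists [ffun i : 'I_(size f) => inord `|(r`_i %% p)%Z|].
  have /(congr1 (fun g => (map_poly (intr : int -> k) g).[z])) :=
    Pdiv.RingMonic.rdivp_eq fm 'X^m.
  rewrite rmorphXn rmorphD rmorphM /= map_polyX !hornerE (eqP fz) mulr0 add0r => ->.
  have rs : (size (map_poly (intr : int -> k) r) <= size f)%N.
    apply: leq_trans (size_poly _ _) _; apply: ltnW.
    by rewrite Pdiv.Ring.ltn_rmodp monic_neq0.
  rewrite (horner_coef_wide _ rs); apply: eq_bigr => i _.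
  by rewrite ffunE -intrE coef_map.
have [i [j [ij FF]]] : exists i j, (i < j)%N /\ F (p ^ i)%N = F (p ^ j)%N.
  pose T : finType := {ffun 'I_(size f) -> 'I_p.+1}.
  have /injectivePn[i [j ij FF]] : ~~ injectiveb (fun i : 'I_#|T|.+1 => F (p ^ i)%N : T).
    by apply/injectiveP => /leq_card; rewrite card_ord ltnn.
  by have [lt|lt|/val_inj ij'] := ltngtP i j;
    [exists i, j|exists j, i|rewrite ij' eqxx in ij].
have zij : z ^+ (p ^ i) = z ^+ (p ^ j) by rewrite !FE FF.
have frob_inj m x y : x ^+ (p ^ m) = y ^+ (p ^ m) -> x = y :> k.
  elim: m => [|m IH]; first by rewrite !expr1.
  rewrite expnS mulnC !exprM -!(pFrobenius_autE charp) => /fmorph_inj; exact: IH.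
exists (z ^+ (p ^ (j - i).-1)); rewrite -exprM -expnSr prednK ?subn_gt0 //.
by apply: (frob_inj i); rewrite -exprM -expnD subnK // ltnW.
Qed.

(** * Residue fields are perfect of characteristic not 2 *)

Section Residue.
Variables (F : fieldExtType rat) (D : set (nzprime (integers F))).
Variable p : nzprime (Dintegers D).
Local Notation k := (residue_field p).

Lemma residue_integers_pth_root (x : Dintegers D) l : l \in [pchar k] ->
  Dintegers_val x \in @integers_pred F -> exists y : k, y ^+ l = residue p x.
Proof.
move=> charl /asboolP[f fm fx]; apply: (integral_pth_root charl fm).
have fx' : (map_poly intr f).[x] = 0.
  apply: val_inj; rewrite rmorph0 -horner_map.
  rewrite [X in X.[_]](_ : _ = map_poly intr f); first exact/eqP.
  by apply/polyP => i; rewrite !coef_map; apply: rmorph_int.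
rewrite rootE -[map_poly _ f](_ : map_poly (residue p) (map_poly intr f) = _).
  by rewrite horner_map fx' rmorph0.
by apply/polyP => i; rewrite !coef_map; apply: rmorph_int.
Qed.

(** Every residue is a quotient of residues of two algebraic integers, the denominator being a unit
    of [Dintegers D]; take the root of each. *)
Lemma residue_field_perfect l : l \in [pchar k] -> forall z : k, exists y, y ^+ l = z.
Proof.
move=> charl z; have [x <-] := residue_surj z.
have /asboolP[a [b [b0 bD xE]]] := valP x.
have vb0 : val b != 0 by apply: integers_val_neq0.
have inD (c : integers F) : val c \in Dintegers_pred D.
  apply/asboolP; exists c, 1; split; first exact: oner_neq0.
    by move=> q; rewrite (idealr1 (nzprime_mem q : prime_idealr _)).
  by rewrite rmorph1 divr1.
have ibP : (val b)^-1 \in Dintegers_pred D.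
  by apply/asboolP; exists 1, b; split => //; rewrite rmorph1 div1r.
pose a' := DIntegers (inD a); pose b' := DIntegers (inD b).
have b'0 : residue p b' != 0.
  have : residue p b' * residue p (DIntegers ibP) = 1.
    rewrite -rmorphM -[RHS](rmorph1 (residue p)); congr (residue p _).
    by apply: val_inj; rewrite rmorphM rmorph1 /= divff.
  by apply: contra_eq_neq => ->; rewrite mul0r eq_sym oner_neq0.
have ab : residue p x * residue p b' = residue p a'.
  rewrite -rmorphM; congr (residue p _).
  by apply: val_inj; rewrite rmorphM /= xE divfK.
have [u uE] := residue_integers_pth_root (x := a') charl (valP a).
have [v vE] := residue_integers_pth_root (x := b') charl (valP b).
exists (u / v); rewrite expr_div_n uE vE -ab mulfK //.
Qed.

(** All primes above 2 lie in D, so 1/2 belongs to [Dintegers D]. *)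
Lemma residue_two_neq0 :
  (forall q : nzprime (integers F), 2%:R \in q -> D q) -> 2%:R != 0 :> k.
Proof.
move=> D2; have two0 : 2%:R != 0 :> F.
  by rewrite -(rmorph_nat (in_alg F)) fmorph_eq0.
have halfP : (2%:R)^-1 \in Dintegers_pred D.
  apply/asboolP; exists 1, 2%:R; split => //.
  by rewrite rmorph1 rmorph_nat div1r.
have : residue p 2%:R * residue p (DIntegers halfP) = 1.
  rewrite -rmorphM -[RHS](rmorph1 (residue p)); congr (residue p _).
  by apply: val_inj; rewrite rmorphM rmorph1 rmorph_nat /= divff.
by rewrite rmorph_nat; apply: contra_eq_neq => ->; rewrite mul0r eq_sym oner_neq0.
Qed.

End Residue.

(* Popcount recovers the length of a list from its code, as [CodeSeq.code]    *)
(* writes a list as a binary word with one digit 1 per entry.                 *)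
Section Popcount.

Definition popcount (x : nat) : nat := \sum_(i < x) odd (iter i half x).

Lemma popcount_wide x y : (x <= y)%N ->
  popcount x = (\sum_(i < y) odd (iter i half x))%N.
Proof.
move=> xy; rewrite /popcount -(subnKC xy) big_split_ord /= [X in (_ + X)%N]big1 ?addn0 //.
move=> i _; suff -> : iter (x + i) half x = 0%N by [].
have h j : (iter j half x <= x - j)%N.
  elim: j => [|j IH]; first by rewrite subn0.
  by rewrite iterS; move: IH; set u := iter _ _ _; lia.
by apply/eqP; rewrite -leqn0; apply: leq_trans (h _) _; lia.
Qed.

Lemma popcount_half x : popcount x = (odd x + popcount x./2)%N.
Proof.
rewrite (popcount_wide (leqnSn x)) big_ord_recl /=; congr addn.
rewrite (@popcount_wide x./2 x); last by lia.
by apply: eq_bigr => i _; rewrite -iterSr /=.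
Qed.

Lemma popcount_code (s : seq nat) : popcount (CodeSeq.code s) = size s.
Proof.
elim: s => [|n s IH]; first by rewrite /popcount big_ord0.
rewrite /= -IH; elim: n => [|n IHn].
  by rewrite mul1n popcount_half /= odd_double uphalf_double.
rewrite expnS -mulnA popcount_half oddM /= add0n.
by rewrite mul2n doubleK.
Qed.

End Popcount.

Lemma popcount_pickle (T : countType) (s : seq T) : popcount (pickle s) = size s.
Proof. by rewrite -[pickle s]/(CodeSeq.code (map pickle s)) popcount_code size_map. Qed.

(** * The bound as a recursive function *)

Section Computability.

Lemma computes_comp1 f g xs x y :
  computes g xs x -> computes f [:: x] y -> computes (RComp f [:: g]) xs y.
Proof.
by move=> hg; apply: computes_comp; apply: computes_all_cons hg _; apply: computes_all_nil.
Qed.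

Lemma computes_comp2 f g h xs x y z :
  computes g xs x -> computes h xs y -> computes f [:: x; y] z ->
  computes (RComp f [:: g; h]) xs z.
Proof.
move=> hg hh; apply: computes_comp; apply: computes_all_cons hg _.
by apply: computes_all_cons hh _; apply: computes_all_nil.
Qed.

(** In the step function of [RPrec], [RProj 0] is the counter, [RProj 1] the previous value and
    [RProj 2] the first parameter. *)
Definition radd := RPrec (RProj 0) (RComp RSucc [:: RProj 1]).
Definition riszero := RPrec (RComp RSucc [:: RZero]) RZero.
Definition rodd := RPrec RZero (RComp riszero [:: RProj 1]).
Definition rhalf := RPrec RZero (RComp radd [:: RProj 1; RComp rodd [:: RProj 0]]).
Definition rhalves := RPrec (RProj 0) (RComp rhalf [:: RProj 1]).
Definition rpopsum :=
  RPrec RZero (RComp radd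
    [:: RProj 1; RComp rodd [:: RComp rhalves [:: RProj 0; RProj 2]]]).
Definition rpopcount i := RComp rpopsum [:: RProj i; RProj i].
Definition rconst n := iter n (fun r => RComp RSucc [:: r]) RZero.
(** Arguments 2 and 3 are the codes of gamma and c1, whose popcounts are the sizes. *)
Definition rbound :=
  RComp radd [:: RComp radd [:: RComp radd [:: rpopcount 2; rpopcount 3];
                                RComp radd [:: rpopcount 2; rpopcount 3]];
                 rconst 32].

Lemma computes_radd a b xs : computes radd [:: a, b & xs] (a + b).
Proof.
elim: a => [|a IH]; first by apply: computes_prec0; apply: (@computes_proj 0).
apply: (computes_precS IH); apply: computes_comp1 (computes_succ _ _).
exact: (@computes_proj 1).
Qed.

Lemma computes_riszero a xs : computes riszero (a :: xs) (a == 0%N).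
Proof.
elim: a => [|a IH]; last by apply: (computes_precS IH); apply: computes_zero.
by apply: computes_prec0; apply: computes_comp1 (computes_zero _) (computes_succ _ _).
Qed.

Lemma computes_rodd a xs : computes rodd (a :: xs) (odd a).
Proof.
elim: a => [|a IH]; first by apply: computes_prec0; apply: computes_zero.
apply: (computes_precS IH); apply: computes_comp1; first exact: (@computes_proj 1).
by have := computes_riszero (odd a) [::]; rewrite eqb0.
Qed.

Lemma computes_rhalf a xs : computes rhalf (a :: xs) a./2.
Proof.
elim: a => [|a IH]; first by apply: computes_prec0; apply: computes_zero.
apply: (computes_precS IH); rewrite -[a.+1./2]/(uphalf a) uphalf_half addnC.
apply: computes_comp2 (computes_radd _ _ _); first exact: (@computes_proj 1).
by apply: computes_comp1 (computes_rodd _ _); apply: (@computes_proj 0).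
Qed.

Lemma computes_rhalves i x xs : computes rhalves [:: i, x & xs] (iter i half x).
Proof.
elim: i => [|i IH]; first by apply: computes_prec0; apply: (@computes_proj 0).
apply: (computes_precS IH); apply: computes_comp1 (computes_rhalf _ _).
exact: (@computes_proj 1).
Qed.

Lemma computes_rpopsum n x xs :
  computes rpopsum [:: n, x & xs] (\sum_(i < n) odd (iter i half x)).
Proof.
elim: n => [|n IH].
  by rewrite big_ord0; apply: computes_prec0; apply: computes_zero.
apply: (computes_precS IH); rewrite big_ord_recr /=.
apply: computes_comp2 (computes_radd _ _ _); first exact: (@computes_proj 1).
apply: computes_comp1 (computes_rodd _ _).
apply: computes_comp2 (computes_rhalves _ _ _); first exact: (@computes_proj 0).
exact: (@computes_proj 2).
Qed.

Lemma computes_rpopcount i xs : (i < size xs)%N ->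
  computes (rpopcount i) xs (popcount (nth 0%N xs i)).
Proof.
by move=> ilt; apply: computes_comp2 (computes_rpopsum _ _ _); apply: computes_proj.
Qed.

Lemma computes_rconst n xs : computes (rconst n) xs n.
Proof.
elim: n => [|n IH]; first exact: computes_zero.
exact: computes_comp1 IH (computes_succ _ _).
Qed.

Lemma computes_rbound x y u v :
  computes rbound [:: x; y; u; v] (zsigmondy_bound (popcount u) (popcount v)).
Proof.
have add_uv : computes (RComp radd [:: rpopcount 2; rpopcount 3]) [:: x; y; u; v]
    (popcount u + popcount v).
  apply: computes_comp2 (computes_radd _ _ _); last exact: (@computes_rpopcount 3).
  exact: (@computes_rpopcount 2).
apply: computes_comp2 (computes_radd _ _ _); last exact: computes_rconst.
by rewrite -addnn; apply: computes_comp2 (computes_radd _ _ _).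
Qed.

End Computability.

Theorem theorem1p3 :
  exists algorithm : recfun,
  forall (F : fieldExtType rat) (D : set (nzprime (integers F)))
    (D_finite : finite_set D)
    (D_two : forall q : nzprime (integers F), 2%:R \in q -> D q)
    (gamma c1 : {poly Dintegers D})
    (not_isotrivial : ~ isotrivial
       (quad (map_poly (val : Dintegers D -> F) gamma)
             (map_poly (val : Dintegers D -> F) c1)))
    (c1_neq0 : c1 != 0),
  exists N : nat,
    (forall w : seq nat, presents gamma c1 w -> computes algorithm w N) /\
    (forall (p : nzprime (Dintegers D)) (n : nat),
       ~ isotrivial (quad (map_poly (residue p) gamma)
                          (map_poly (residue p) c1)) ->
       map_poly (residue p) c1 != 0 ->
       sqfree_zsigmondy (map_poly (residue p) gamma)
                        (map_poly (residue p) c1) n ->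
       (n <= N)%N).
Proof.
exists rbound => F D _ D2 gamma c1 _ _.
exists (zsigmondy_bound (size gamma) (size c1)); split.
  move=> w [b [gens [_ _ _ ->]]].
  (* Whatever the basis b, there is one entry per coefficient, so N does not depend on the
     presentation. *)
  have popE (f : {poly Dintegers D}) :
      popcount (pickle [seq coordinates b (val x) | x <- f : seq _]) = size f.
    by rewrite popcount_pickle size_map.
  by rewrite -(popE gamma) -(popE c1); apply: computes_rbound.
move=> p n niso c0 nZ.
have := zsigmondy_le (residue_two_neq0 p D2) (residue_field_perfect (p := p))
  (not_isotrivial_pdeg niso) c0 nZ.
move=> /leq_trans; apply.
(* Reduction does not increase sizes. *)
by rewrite leq_add2r leq_double leq_add // size_poly.
Qed.
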